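(* Let $f:\mathbb{T}^2\to\mathbb{T}^2$ be a non-resonant torus homeomorphism. Then $f$ is chain-transitive; that is, for every pair of points $x,y\in\mathbb{T}^2$ and every $\varepsilon>0$ there exist $n\geq 1$ and points $x=z_0,z_1,\ldots,z_n=y$ in $\mathbb{T}^2$ with $d(z_{i+1},f(z_i))<\varepsilon$ for all $0\leq i\leq n-1$.
   Context: $\mathbb{T}^2=\mathbb{R}^2/\mathbb{Z}^2$ with its usual distance $d$. $\mathrm{Homeo}_0(\mathbb{T}^2)$ is the set of homeomorphisms of $\mathbb{T}^2$ homotopic to the identity. The rotation set of a lift $F:\mathbb{R}^2\to\mathbb{R}^2$ of $f\in\mathrm{Homeo}_0(\mathbb{T}^2)$ is the set of all limits of sequences $\frac{F^{n_i}(z_i)-z_i}{n_i}$ with $z_i\in\mathbb{R}^2$, $n_i\to+\infty$; changing the lift translates it by an integer vector. $f\in\mathrm{Homeo}_0(\mathbb{T}^2)$ is called non-resonant if its rotation set is a single vector $(\alpha,\beta)$ (defined modulo $\mathbb{Z}^2$) such that $1,\alpha,\beta$ are rationally independent (linearly independent over $\mathbb{Q}$). Equivalently, for every lift $F$ and every $z\in\mathbb{R}^2$, $\lim_{n\to\infty}\frac{F^n(z)-z}{n}=(\alpha,\beta)\ (\mathrm{mod}\ \mathbb{Z}^2)$ with $1,\alpha,\beta$ rationally independent. *)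

(* Defs.v *)
From HB Require Import structures.
From mathcomp Require Import all_boot all_order all_algebra.
From mathcomp Require Import generic_quotient.
From mathcomp Require Import all_classical all_reals all_analysis.
Set Implicit Arguments.
Unset Strict Implicit.
Unset Printing Implicit Defensive.
Import Order.TTheory GRing.Theory Num.Theory.
Import numFieldNormedType.Exports.
Local Open Scope classical_set_scope.
Local Open Scope ring_scope.
Local Open Scope quotient_scope.

Section Torus.
Variable R : realType.

Definition congZ2 : rel (R * R) := fun x y =>
  (x.1 - y.1 \is a Num.int) && (x.2 - y.2 \is a Num.int).

Lemma congZ2_refl : reflexive congZ2.
Proof. by move=> x; rewrite /congZ2 !subrr !rpred0. Qed.

Lemma congZ2_sym : symmetric congZ2.
Proof.
by move=> x y; rewrite /congZ2 -(opprB y.1) -(opprB y.2) !rpredN.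
Qed.

Lemma congZ2_trans : transitive congZ2.
Proof.
move=> y x z /andP[xy1 xy2] /andP[yz1 yz2]; apply/andP; split.
- by have := rpredD xy1 yz1; rewrite addrA subrK.
- by have := rpredD xy2 yz2; rewrite addrA subrK.
Qed.

Canonical congZ2_equiv :=
  EquivRel congZ2 congZ2_refl congZ2_sym congZ2_trans.

Definition torus : Type := quotient_topology {eq_quot congZ2}.

HB.instance Definition _ := Topological.on torus.
HB.instance Definition _ := Quotient.on torus.

Definition torus_proj (z : R * R) : torus := \pi_torus z.

Lemma torus_projP (z w : R * R) :
  torus_proj z = torus_proj w <->
  (z.1 - w.1 \is a Num.int) /\ (z.2 - w.2 \is a Num.int).
Proof.
have E : torus_proj z = torus_proj w <-> congZ2 z w.
  by split=> [|h]; [move=> /eqmodP | apply/eqmodP].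
by rewrite E /congZ2; split=> [/andP[]|[-> ->]].
Qed.

(* The norm on [R * R] in the library is the sup norm, hence the explicit
   Euclidean distance. *)
Definition eucl_dist (z w : R * R) : R :=
  Num.sqrt ((z.1 - w.1) ^+ 2 + (z.2 - w.2) ^+ 2).

Definition torus_dist (x y : torus) : R :=
  inf [set r | exists z w : R * R,
    [/\ torus_proj z = x, torus_proj w = y & r = eucl_dist z w]].

Definition homeomorphism (f : torus -> torus) : Prop :=
  continuous f /\
  exists g : torus -> torus, [/\ continuous g, cancel f g & cancel g f].

Definition homotopic (f g : torus -> torus) : Prop :=
  exists H : R * torus -> torus,
    [/\ {within `[0, 1] `*` [set: torus], continuous H},
        forall x, H (0, x) = f x & forall x, H (1, x) = g x].

Definition Homeo0 (f : torus -> torus) : Prop :=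
  homeomorphism f /\ homotopic f id.

Definition is_lift (f : torus -> torus) (F : R * R -> R * R) : Prop :=
  continuous F /\ forall z, torus_proj (F z) = f (torus_proj z).

Definition rotation_set (F : R * R -> R * R) : set (R * R) :=
  [set v | exists (n : nat -> nat) (z : nat -> R * R),
    n @ \oo --> \oo /\
    (fun i => (n i)%:R^-1 *: (iter (n i) F (z i) - z i)) @ \oo --> v].

Definition rationally_independent (a b : R) : Prop :=
  forall p q r : rat,
    ratr p + ratr q * a + ratr r * b = 0 -> [/\ p = 0, q = 0 & r = 0].

(* Changing the lift translates the rotation set by an integer vector, which
   preserves the condition below: one lift is enough. *)
Definition non_resonant (f : torus -> torus) : Prop :=
  Homeo0 f /\
  exists (F : R * R -> R * R) (a b : R),
    [/\ is_lift f F, rotation_set F = [set (a, b)]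
      & rationally_independent a b].

Definition chain_transitive (f : torus -> torus) : Prop :=
  forall (x y : torus) (e : R), 0 < e ->
    exists (n : nat) (z : nat -> torus),
      [/\ (1 <= n)%N, z 0%N = x, z n = y
        & forall i : nat, (i < n)%N -> torus_dist (z i.+1) (f (z i)) < e].

End Torus.

(* Main.v *)
Require Import Defs.
From mathcomp Require Import all_boot all_order all_algebra.
From mathcomp Require Import generic_quotient.
From mathcomp Require Import all_classical all_reals all_analysis.
From mathcomp Require Import ring lra zify.
Set Implicit Arguments.
Unset Strict Implicit.
Unset Printing Implicit Defensive.
Import Order.TTheory GRing.Theory Num.Theory.
Import numFieldNormedType.Exports.
Local Open Scope classical_set_scope.
Local Open Scope ring_scope.

(** Why non-resonance forces chain transitivity.

    Suppose that [y] cannot be reached from [x] by pseudo-orbits with jumps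
    smaller than [e].  Lift to the plane: let [U] be the set of points whose
    projection is reached from [x].  It is nonempty, not the whole plane,
    invariant under integer translations, and a neighbourhood of [F U] of
    uniform width lies in [U].  The complement has the same property for
    [G = F^-1]: the set [W] of points close to the complement of [U] satisfies
    that a uniform neighbourhood of [G W] lies in [W], and [G W] misses [U].

    Call two points of [U] equivalent when a chain of small jumps inside [U]
    joins them; these classes play the part of connected components.  Up to
    integer translations there are finitely many of them, since the points of
    one small cell are equivalent, and [F] maps classes into classes.  Hence
    some iterate [F^k] carries a class [C] into a translate [C + v]
    ([component_returns]).  Consider the group of integer vectors [w] with
    [C + w = C].  If an integral linear functional vanishes on it, then the
    functional is bounded on [C], which is a finite union of pieces of cells
    modulo that group; comparing with the rotation vector [r] gives the same
    value to [k r] and to [v], so irrationality makes the functional zero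
    ([functional_on_stabiliser]).  So the group has rank two, and [C] contains
    chains from some [z] to [z + (M, 0)] and to [z + (0, M)]
    ([component_doubly_periodic]).

    The image under [F] of a horizontal chain for [U] and the image under [G]
    of a vertical chain for [W], both prolonged periodically, have to cross in
    the plane ([periodic_chains_cross]).  At the crossing a point of the
    complement of [U] is close to a point of [F U], hence belongs to [U], a
    contradiction ([absorbed_set_full]).

    What remains is to check that the lift is as required: it commutes with
    integer translations and its displacement converges uniformly to the
    rotation vector.  Both are read off the rotation set being a single point
    [r], through the remark that for large [n] no mean displacement lies in a
    given compact annulus around [r] ([mean_disp_annulus]): a limit of such
    displacements would be another rotation vector.  If [F^n] acted
    non-trivially on the lattice, the mean displacements of order [n] would
    form an unbounded connected set, which meets the annulus as soon as one of
    them is near [r] ([iter_fixes_lattice], [lift_commutes]). *)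

(** * Crossing of planar chains *)

Lemma addb_telescope (s : nat -> bool) n :
  \big[addb/false]_(i < n) (s i (+) s i.+1) = s 0%N (+) s n.
Proof.
elim: n => [|n IH]; first by rewrite big_ord0 addbb.
by rewrite big_ord_recr /= IH; case: (s n); case: (s 0%N); case: (s n.+1).
Qed.

(** Each interior edge belongs to two unit squares, so it cancels modulo two
    from the sum over all squares: only the boundary of the grid remains. *)
Lemma addb_green (h v : nat -> nat -> bool) n m :
  \big[addb/false]_(i < n) \big[addb/false]_(j < m)
     ((h i j (+) h i j.+1) (+) (v i j (+) v i.+1 j)) =
  \big[addb/false]_(i < n) (h i 0%N (+) h i m) (+)
  \big[addb/false]_(j < m) (v 0%N j (+) v n j).
Proof.
under eq_bigr do rewrite big_split /= addb_telescope.
rewrite big_split /= exchange_big /=; congr (_ (+) _).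
by apply: eq_bigr => j _; exact: (addb_telescope (fun i => v i j)).
Qed.

(** A discrete Poincare-Miranda theorem.  The values of [a] and [b] stand for
    the signs of the two coordinates of a planar vector field.  Count the edges
    across which [a] changes while [b] is false at both ends.  On the boundary
    of the grid such edges occur on the bottom side only, in odd number; hence
    some unit square has an odd number of them on its boundary, which is
    impossible if [a] or [b] is constant on its four corners. *)
Lemma two_signs_square (a b : nat -> nat -> bool) n m :
  (forall j, (j <= m)%N -> a 0%N j = false) ->
  (forall j, (j <= m)%N -> a n j = true) ->
  (forall i, (i <= n)%N -> b i 0%N = false) ->
  (forall i, (i <= n)%N -> b i m = true) ->
  exists i j, [/\ (i < n)%N, (j < m)%N,
    ~~ [&& a i j == a i.+1 j, a i j == a i j.+1 & a i j == a i.+1 j.+1] &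
    ~~ [&& b i j == b i.+1 j, b i j == b i j.+1 & b i j == b i.+1 j.+1]].
Proof.
move=> aL aR bB bT.
pose h i j := ~~ b i j && ~~ b i.+1 j && (a i j (+) a i.+1 j).
pose v i j := ~~ b i j && ~~ b i j.+1 && (a i j (+) a i j.+1).
have odd_boundary : \big[addb/false]_(i < n) (h i 0%N (+) h i m) (+)
    \big[addb/false]_(j < m) (v 0%N j (+) v n j) = true.
  rewrite [X in _ (+) X]big1 => [|j _]; last first.
    have jm := ltn_ord j; have jm' := ltnW jm.
    by rewrite /v !aL // !aR // !andbF.
  rewrite addbF.
  transitivity (a 0%N 0%N (+) a n 0%N); last by rewrite aL // aR.
  rewrite -(addb_telescope (fun i => a i 0%N)); apply: eq_bigr => i _.
  have im := ltn_ord i; have im' := ltnW im.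
  by rewrite /h !bB // !bT // addbF.
rewrite -addb_green in odd_boundary.
apply: contrapT => no_square; move: odd_boundary.
rewrite big1 // => i _; apply: big1 => j _.
have : ~~ (~~ [&& a i j == a i.+1 j, a i j == a i j.+1 & a i j == a i.+1 j.+1]
  && ~~ [&& b i j == b i.+1 j, b i j == b i j.+1 & b i j == b i.+1 j.+1]).
  by apply/negP => /andP[na nb]; apply: no_square; exists i, j.
rewrite /h /v.
by case: (a i j); case: (a i.+1 j); case: (a i j.+1); case: (a i.+1 j.+1);
  case: (b i j); case: (b i.+1 j); case: (b i j.+1); case: (b i.+1 j.+1).
Qed.

Section Plane.
Variable R : realType.
Implicit Types (z w v : R * R) (e d : R).

Lemma norm_pair_le z e : (`|z| <= e) = (`|z.1| <= e) && (`|z.2| <= e).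
Proof. by rewrite prod_normE ge_max. Qed.

Lemma norm_pair_lt z e : (`|z| < e) = (`|z.1| < e) && (`|z.2| < e).
Proof. by rewrite prod_normE gt_max. Qed.

(** [two_signs_square] applied to the signs of the coordinates of [p i - q j]:
    both coordinates change sign on one unit square, over which they vary by at
    most [2 * d]. *)
Lemma chains_cross (p q : nat -> R * R) n m d :
  (forall i, (i < n)%N -> `|p i.+1 - p i| <= d) ->
  (forall j, (j < m)%N -> `|q j.+1 - q j| <= d) ->
  (forall j, (j <= m)%N -> (p 0%N).1 < (q j).1) ->
  (forall j, (j <= m)%N -> (q j).1 <= (p n).1) ->
  (forall i, (i <= n)%N -> (q 0%N).2 < (p i).2) ->
  (forall i, (i <= n)%N -> (p i).2 <= (q m).2) ->
  exists i j, `|p i - q j| <= 2 * d.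
Proof.
move=> dp dq pL pR qB qT.
have [||||i [j [ltin ltjm]]] := @two_signs_square
    (fun i j => (q j).1 <= (p i).1) (fun i j => (p i).2 <= (q j).2) n m.
- by move=> j /pL; rewrite real_ltNge ?num_real// => /negbTE.
- by move=> j /pR.
- by move=> i /qB; rewrite real_ltNge ?num_real// => /negbTE.
- by move=> i /qT.
move: (dp _ ltin) (dq _ ltjm); rewrite !norm_pair_le /=.
move=> /andP[p1 p2] /andP[q1 q2] a b; exists i, j.
rewrite norm_pair_le /=; apply/andP; split.
- clear - p1 q1 a; move: p1 q1 a.
  rewrite !ler_norml => /andP[? ?] /andP[? ?].
  case: (lerP (q j).1 (p i).1) => ?; case: (lerP (q j).1 (p i.+1).1) => ?;
  case: (lerP (q j.+1).1 (p i).1) => ?;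
  by case: (lerP (q j.+1).1 (p i.+1).1) => ? //= _; lra.
- clear - p2 q2 b; move: p2 q2 b.
  rewrite !ler_norml => /andP[? ?] /andP[? ?].
  case: (lerP (p i).2 (q j).2) => ?; case: (lerP (p i.+1).2 (q j).2) => ?;
  case: (lerP (p i).2 (q j.+1).2) => ?;
  by case: (lerP (p i.+1).2 (q j.+1).2) => ? //= _; lra.
Qed.

Lemma finite_bound (u : nat -> R) n :
  exists B, forall i, (i <= n)%N -> u i <= B.
Proof.
elim: n => [|n [B hB]]; first by exists (u 0%N) => -[].
exists (Num.max B (u n.+1)) => i; rewrite leq_eqVlt => /predU1P[->|].
  by rewrite le_max lexx orbT.
by rewrite ltnS => /hB h; rewrite le_max h.
Qed.

Definition int_vec v := (v.1 \is a Num.int) && (v.2 \is a Num.int).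

Lemma int_vec0 : int_vec 0.
Proof. by rewrite /int_vec !rpred0. Qed.

Lemma int_vecD v w : int_vec v -> int_vec w -> int_vec (v + w).
Proof. by move=> /andP[? ?] /andP[? ?]; rewrite /int_vec /= !rpredD. Qed.

Lemma int_vecN v : int_vec v -> int_vec (- v).
Proof. by move=> /andP[? ?]; rewrite /int_vec /= !rpredN; apply/andP. Qed.

Lemma int_vecMn v n : int_vec v -> int_vec (v *+ n).
Proof.
move=> hv; elim: n => [|n IH]; first exact: int_vec0.
by rewrite mulrS int_vecD.
Qed.

(** The periodic prolongation of a chain [p 0, ..., p n] with
    [p n = p 0 + v]. *)
Definition unroll (p : nat -> R * R) n v i := p (i %% n)%N + v *+ (i %/ n).

Lemma unroll_step p n v d : (0 < n)%N -> p n = p 0%N + v ->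
  (forall i, (i < n)%N -> `|p i.+1 - p i| <= d) ->
  forall i, `|unroll p n v i.+1 - unroll p n v i| <= d.
Proof.
move=> n0 pn dp i; rewrite /unroll.
have ltr : (i %% n < n)%N by rewrite ltn_mod.
have [E|ne] := eqVneq (i %% n).+1 n.
  have -> : (i.+1 %% n = 0)%N.
    by rewrite {1}(divn_eq i n) -addnS E -mulSnr modnMl.
  have -> : (i.+1 %/ n = (i %/ n).+1)%N.
    by rewrite {1}(divn_eq i n) -addnS E -mulSnr mulnK.
  rewrite mulrS addrA -pn opprD addrACA subrr addr0.
  by rewrite -[X in p X - _]E; apply: dp.
have lt1 : ((i %% n).+1 < n)%N by rewrite ltn_neqAle ne.
have -> : (i.+1 %% n = (i %% n).+1)%N.
  by rewrite {1}(divn_eq i n) -addnS modnMDl modn_small.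
have -> : (i.+1 %/ n = i %/ n)%N.
  by rewrite {1}(divn_eq i n) -addnS divnMDl // (divn_small lt1) addn0.
by rewrite opprD addrACA subrr addr0; apply: dp.
Qed.

(** Prolonged far enough in both directions, a horizontally periodic chain
    passes from the left to the right of a vertically periodic one and stays
    between its two ends. *)
Lemma periodic_chains_cross (p q : nat -> R * R) n m (M M' : nat) d :
  (0 < M)%N -> (0 < M')%N ->
  (forall i, (i < n)%N -> `|p i.+1 - p i| <= d) ->
  (forall j, (j < m)%N -> `|q j.+1 - q j| <= d) ->
  p n = p 0%N + (M%:R, 0) -> q m = q 0%N + (0, M'%:R) ->
  exists i j v, [/\ (i <= n)%N, (j <= m)%N, int_vec v &
    `|p i - q j + v| <= 2 * d].
Proof.
move=> M0 M'0 dp dq pn qm.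
have n0 : (0 < n)%N.
  rewrite lt0n; apply/negP => /eqP E; move: pn; rewrite E => /(congr1 fst) /=.
  move=> E1; have /eqP : (M%:R : R) = 0 by lra.
  by rewrite pnatr_eq0 eqn0Ngt M0.
have m0 : (0 < m)%N.
  rewrite lt0n; apply/negP => /eqP E; move: qm; rewrite E => /(congr1 snd) /=.
  move=> E1; have /eqP : (M'%:R : R) = 0 by lra.
  by rewrite pnatr_eq0 eqn0Ngt M'0.
have [B1 hB1] := finite_bound (fun i => `|p i|) n.
have [B2 hB2] := finite_bound (fun i => `|q i|) m.
pose B := B1 + B2.
have B10 : 0 <= B1 by apply: le_trans (hB1 0%N _).
have B20 : 0 <= B2 by apply: le_trans (hB2 0%N _).
have pB i : (i <= n)%N -> (`|(p i).1| <= B) && (`|(p i).2| <= B).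
  by move=> /hB1 h; rewrite -norm_pair_le (le_trans h)// lerDl.
have qB i : (i <= m)%N -> (`|(q i).1| <= B) && (`|(q i).2| <= B).
  by move=> /hB2 h; rewrite -norm_pair_le (le_trans h)// lerDr.
(* [K] periods on each side move the ends past the box of size [B] that
   contains both base chains. *)
pose K := (Num.trunc (2 * B)).+1.
have KB : 2 * B < K%:R by rewrite truncnS_gt.
have KM (k : nat) : (0 < k)%N -> 2 * B < k%:R *+ K.
  move=> k0; rewrite -mulrnA; apply: lt_le_trans KB _.
  by rewrite ler_nat leq_pmull.
pose e1 : R * R := (M%:R, 0); pose e2 : R * R := (0, M'%:R).
pose P i := unroll p n e1 i - e1 *+ K.
pose Q i := unroll q m e2 i - e2 *+ K.
have e1n k : e1 *+ k = (M%:R *+ k, 0).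
  elim: k => [|k IH]; first by rewrite !mulr0n.
  by rewrite !mulrS IH; congr pair; rewrite /= addr0.
have e2n k : e2 *+ k = (0, M'%:R *+ k).
  elim: k => [|k IH]; first by rewrite !mulr0n.
  by rewrite !mulrS IH; congr pair; rewrite /= addr0.
have [|||||| i [j hij]] := @chains_cross P Q (n * (K + K)) (m * (K + K)) d.
- move=> i _; rewrite /P opprB addrA subrK; exact: unroll_step.
- move=> i _; rewrite /Q opprB addrA subrK; exact: unroll_step.
- move=> j _; rewrite /P /Q /unroll mod0n div0n mulr0n addr0 e1n !e2n /=.
  have /andP[+ _] := pB 0%N isT; have /andP[+ _] := qB (j %% m)%N (ltnW (ltn_pmod _ m0)).
  by have := KM M M0; rewrite !ler_norml => ? /andP[? ?] /andP[? ?]; lra.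
- move=> j _; rewrite /P /Q /unroll modnMr mulKn // !e1n !e2n /=.
  have /andP[+ _] := pB 0%N isT; have /andP[+ _] := qB (j %% m)%N (ltnW (ltn_pmod _ m0)).
  by have := KM M M0; rewrite mulrnDr !ler_norml => ? /andP[? ?] /andP[? ?]; lra.
- move=> i _; rewrite /P /Q /unroll mod0n div0n mulr0n addr0 !e1n !e2n /=.
  have /andP[_ +] := qB 0%N isT; have /andP[_ +] := pB (i %% n)%N (ltnW (ltn_pmod _ n0)).
  by have := KM M' M'0; rewrite !ler_norml => ? /andP[? ?] /andP[? ?]; lra.
- move=> i _; rewrite /P /Q /unroll modnMr mulKn // !e1n !e2n /=.
  have /andP[_ +] := qB 0%N isT; have /andP[_ +] := pB (i %% n)%N (ltnW (ltn_pmod _ n0)).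
  by have := KM M' M'0; rewrite mulrnDr !ler_norml => ? /andP[? ?] /andP[? ?]; lra.
exists (i %% n)%N, (j %% m)%N,
  (e1 *+ (i %/ n) - e1 *+ K - (e2 *+ (j %/ m) - e2 *+ K)).
have E1 : int_vec e1 by rewrite /int_vec /= natr_int rpred0.
have E2 : int_vec e2 by rewrite /int_vec /= natr_int rpred0.
split.
- exact: ltnW (ltn_pmod _ n0).
- exact: ltnW (ltn_pmod _ m0).
- by rewrite !(int_vecD, int_vecN, int_vecMn).
- move: hij; rewrite /P /Q /unroll -[p _ + _ - _]addrA -[q _ + _ - _]addrA.
  by rewrite opprD addrACA.
Qed.

End Plane.

(** * Chain components of an absorbed periodic set *)

Section Chains.
Variable R : realType.
Implicit Types (E : R * R -> R * R -> Prop) (U : set (R * R)) (z w v : R * R).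

Definition chained E z w := exists n (c : nat -> R * R),
  [/\ c 0%N = z, c n = w & forall i, (i < n)%N -> E (c i) (c i.+1)].

Lemma chained0 E z : chained E z z.
Proof. by exists 0%N, (fun=> z). Qed.

Lemma chained1 E z w : E z w -> chained E z w.
Proof. by move=> zw; exists 1%N, (fun i => if i is 0%N then z else w); split=> // -[]. Qed.

Lemma chained_trans E y z w : chained E z y -> chained E y w -> chained E z w.
Proof.
move=> [n1 [c1 [c10 c1n E1]]] [n2 [c2 [c20 c2n E2]]].
exists (n1 + n2)%N, (fun i => if (i < n1)%N then c1 i else c2 (i - n1)%N).
split.
- case: ifP => // /negbT; rewrite -leqNgt leqn0 => /eqP n10.
  by rewrite n10 subnn c20 -c1n n10 c10.
- by rewrite ltnNge leq_addr addKn.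
- move=> i lti; have [ltin|lein] := ltnP i n1.
    case: ltnP => [_|ge]; first exact: E1.
    have -> : (i.+1 - n1 = 0)%N by apply/eqP; rewrite subn_eq0.
    have e : i.+1 = n1 by apply/eqP; rewrite eqn_leq ltin ge.
    by rewrite c20 -c1n -e; apply: E1; rewrite -e.
  rewrite ltnNge (leqW lein) /= subSn //; apply: E2.
  by rewrite ltn_subLR.
Qed.

Lemma chained_map E E' (h : R * R -> R * R) :
  (forall x y, E x y -> chained E' (h x) (h y)) ->
  forall z w, chained E z w -> chained E' (h z) (h w).
Proof.
move=> hE z w [n [c [<- <- Ec]]]; elim: n Ec => [_|n IH Ec].
  exact: chained0.
apply: (@chained_trans _ (h (c n))); first by apply: IH => i /leqW; exact: Ec.
exact/hE/Ec.
Qed.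

Lemma chained_sym E : (forall x y, E x y -> E y x) ->
  forall z w, chained E z w -> chained E w z.
Proof.
move=> sE z w [n [c [<- <- Ec]]]; exists n, (fun i => c (n - i)%N).
rewrite subn0 subnn; split=> // i lti; apply: sE.
by rewrite subnS; have := Ec (n - i).-1; rewrite prednK ?subn_gt0 //; apply; lia.
Qed.

Definition link U (d : R) z w := [/\ U z, U w & `|w - z| < d].

Lemma linkC U d z w : link U d z w -> link U d w z.
Proof. by case=> ? ? ?; split=> //; rewrite distrC. Qed.

Lemma segment_chained U z w (e d : R) : 0 < d ->
  (forall x, `|x - z| < e -> U x) -> `|w - z| < e -> chained (link U d) z w.
Proof.
move=> d0 ballU wz.
pose K := (Num.trunc (`|w - z| / d)).+1.
have Kd : `|w - z| / d < K%:R by rewrite truncnS_gt.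
have K0 : 0 < K%:R :> R by rewrite ltr0n.
exists K, (fun i => z + (i%:R / K%:R) *: (w - z)).
rewrite mul0r scale0r addr0 divff ?gt_eqF// scale1r addrC subrK; split=> // i ltiK.
have inU j : (j <= K)%N -> U (z + (j%:R / K%:R) *: (w - z)).
  move=> lejK; apply: ballU; rewrite addrC addKr normrZ.
  apply: le_lt_trans wz; rewrite ler_piMl // ger0_norm ?divr_ge0//.
  by rewrite ler_pdivrMr // mul1r ler_nat.
split; [exact/inU/ltnW|exact: inU|].
rewrite opprD addrACA subrr add0r -scalerBl -mulrBl -natr1.
rewrite (addrC i%:R) addrK mul1r normrZ ger0_norm ?invr_ge0 ?ltW//.
by rewrite mulrC ltr_pdivrMr // mulrC -ltr_pdivrMr.
Qed.

(** The cells are the squares of a fine grid on the torus, so that the points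
    of a cell are close up to an integer translation. *)
Lemma cells (d : R) : 0 < d -> exists (T : finType) (cell : R * R -> T),
  forall z w, cell z = cell w -> exists2 v, int_vec v & `|w - z - v| < d.
Proof.
move=> d0.
pose N := Num.trunc d^-1.
have Nd : d^-1 < N.+1%:R by rewrite truncnS_gt.
have N0 : 0 < N.+1%:R :> R by rewrite ltr0n.
pose fl (x : R) : R := (Num.floor x)%:~R.
have fl1 (x : R) : 0 <= x - fl x < 1.
  by have := floor_itv x; rewrite intrD /fl => /andP[? ?]; apply/andP; split; lra.
pose c x : 'I_N.+1 := inord (Num.trunc (N.+1%:R * (x - fl x))).
have cP x y : c x = c y -> `|y - x - (fl y - fl x)| < d.
  have trN (t : R) : 0 <= t - fl t < 1 -> (Num.trunc (N.+1%:R * (t - fl t)) < N.+1)%N.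
    move=> /andP[t0 t1]; rewrite -(ltr_nat R); apply: (@le_lt_trans _ _ (N.+1%:R * (t - fl t))).
      by rewrite truncn_le // mulr_ge0 // ltW.
    by rewrite -[X in _ < X]mulr1 ltr_pM2l.
  move=> /(congr1 val) /=; rewrite !inordK ?trN // => E.
  have /andP[x0 x1] := fl1 x; have /andP[y0 y1] := fl1 y.
  have := truncn_itv (mulr_ge0 (ltW N0) x0).
  have := truncn_itv (mulr_ge0 (ltW N0) y0).
  rewrite E -!natr1; set t := _%:R; move=> /andP[ty yt] /andP[tx xt].
  have dN : 1 < d * N.+1%:R by rewrite mulrC -ltr_pdivrMr // div1r.
  rewrite -(ltr_pM2r N0); apply: lt_trans dN.
  rewrite -[X in _ * X]ger0_norm ?ltW// -normrM.
  rewrite ltr_norml; apply/andP; split; lra.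
exists ('I_N.+1 * 'I_N.+1)%type, (fun z => (c z.1, c z.2)) => z w [c1 c2].
exists (fl w.1 - fl z.1, fl w.2 - fl z.2).
  by rewrite /int_vec /= !rpredB //; apply: intr_int.
by rewrite norm_pair_lt /= !cP.
Qed.

Lemma pigeonhole (T : finType) (s : nat -> T) :
  exists m k, (0 < k)%N /\ s m = s (m + k)%N.
Proof.
apply: contrapT => no.
have inj : injective (fun i : 'I_#|T|.+1 => s i).
  move=> i j; wlog lt : i j / (i < j)%N.
    move=> H E; have [lt|lt|] := ltngtP i j; [exact: H|exact/esym/H|exact: val_inj].
  by move=> E; case: no; exists i, (j - i)%N; rewrite subn_gt0 subnKC // ltnW.
by have := leq_card _ inj; rewrite card_ord ltnn.
Qed.

End Chains.

(** In this section [U] is a periodic set such that the neighbourhood of width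
    [eps] of [F U] lies in [U], and [d] is so small that the images of points
    at distance less than [d] are at distance less than [eps]. *)
Section Absorbed.
Variables (R : realType) (F : R * R -> R * R) (a b eps d : R) (U : set (R * R)).
Hypothesis F_per : forall z v, int_vec v -> F (z + v) = F z + v.
Hypothesis F_rot : forall e, 0 < e -> exists N, forall n z, (N <= n)%N ->
  `|iter n F z - z - n%:R *: (a, b)| <= e * n%:R.
Hypothesis irr : rationally_independent a b.
Hypothesis U_per : forall z v, int_vec v -> U z -> U (z + v).
Hypothesis U_abs : forall z w, U z -> `|w - F z| < eps -> U w.
Hypothesis d_gt0 : 0 < d.
Hypothesis F_d : forall z w, `|z - w| < d -> `|F z - F w| < eps.
Implicit Types (z w v : R * R).

Let C := chained (link U d).

Let C_sym z w : C z w -> C w z.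
Proof. exact/chained_sym/linkC. Qed.

Let C_trans y z w : C z y -> C y w -> C z w.
Proof. exact: chained_trans. Qed.

Let C_in z w : U z -> C z w -> U w.
Proof.
move=> Uz [[|n] [c [c0 cn Ec]]]; first by rewrite -cn c0.
by rewrite -cn; case: (Ec n (ltnSn _)).
Qed.

Let C_shift v z w : int_vec v -> C z w -> C (z + v) (w + v).
Proof.
move=> iv; apply: (chained_map (h := fun x => x + v)) => x y [Ux Uy xy].
by apply: chained1; split; [exact: U_per|exact: U_per|rewrite opprD addrACA subrr addr0].
Qed.

(** The image of a jump of size [d] is shorter than [eps], so the segment that
    joins its ends stays in [U] and can be cut into jumps of size [d]. *)
Let C_F z w : C z w -> C (F z) (F w).
Proof.
apply: chained_map => x y [Ux Uy xy].
apply: (segment_chained (e := eps) d_gt0); last exact: F_d.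
by move=> u; exact: U_abs.
Qed.

Let C_iter n z w : C z w -> C (iter n F z) (iter n F w).
Proof. by move=> zw; elim: n => //= n; exact: C_F. Qed.

Let U_iter n z : 0 < eps -> U z -> U (iter n F z).
Proof.
by move=> e0 Uz; elim: n => //= n IH; apply: (U_abs IH); rewrite subrr normr0.
Qed.

Lemma iter_per n z v : int_vec v -> iter n F (z + v) = iter n F z + v.
Proof. by move=> iv; elim: n => //= n ->; rewrite F_per. Qed.

Let eps_gt0 : 0 < eps.
Proof. by have := @F_d 0 0; rewrite !subrr normr0; apply. Qed.

(** Two points of an orbit lie in the same cell; the later one is then in the
    class of an integer translate of the earlier one. *)
Lemma component_returns z0 : U z0 -> exists z k v,
  [/\ U z, (0 < k)%N, int_vec v & C (iter k F z) (z + v)].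
Proof.
move=> Uz0; have [T [cell cellP]] := cells d_gt0.
have [m [k [k0 E]]] := pigeonhole (fun i => cell (iter i F z0)).
have [v iv lt] := cellP _ _ E.
exists (iter m F z0), k, v; split=> //; first exact: U_iter.
rewrite -iterD addnC; apply: chained1; split; [exact: U_iter| |].
  exact/U_per/U_iter.
by rewrite distrC opprD addrA.
Qed.

Variables (z : R * R) (k : nat) (v : R * R).
Hypotheses (Uz : U z) (k_gt0 : (0 < k)%N) (iv : int_vec v)
  (Ckz : C (iter k F z) (z + v)).

Let C_iterk j : C (iter (k * j) F z) (z + v *+ j).
Proof.
elim: j => [|j IH]; first by rewrite muln0 mulr0n addr0; exact: chained0.
rewrite mulnS iterD; apply: C_trans (C_iter k IH) _.
rewrite iter_per ?int_vecMn// mulrS addrA.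
exact/C_shift/Ckz/int_vecMn.
Qed.

Let stab w := int_vec w /\ C z (z + w).

Let stabD w1 w2 : stab w1 -> stab w2 -> stab (w1 + w2).
Proof.
move=> [i1 C1] [i2 C2]; split; first exact: int_vecD.
by apply: (C_trans C2); rewrite addrA; exact: C_shift.
Qed.

Let stabN w : stab w -> stab (- w).
Proof.
move=> [i1 C1]; split; first exact: int_vecN.
by have := C_shift (int_vecN i1) C1; rewrite addrK; exact: C_sym.
Qed.

Let stabZ x w : x \is a Num.int -> stab w -> stab (x *: w).
Proof.
have pos (n : nat) w' : stab w' -> stab (n%:R *: w').
  move=> sw; rewrite scaler_nat; elim: n => [|n IH].
    by rewrite mulr0n; split; [exact: int_vec0|rewrite addr0; exact: chained0].
  by rewrite mulrS; exact: stabD.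
move=> /intrP[[n|n] ->] sw; first exact: pos.
by rewrite NegzE mulrNz scaleNr; apply/stabN/pos.
Qed.

Let phi (p q : R) w := p * w.1 + q * w.2.

Let phiD p q w1 w2 : phi p q (w1 + w2) = phi p q w1 + phi p q w2.
Proof. by rewrite /phi /=; ring. Qed.

Let phi_le p q w : `|phi p q w| <= (`|p| + `|q|) * `|w|.
Proof.
rewrite (le_trans (ler_normD _ _))// !normrM mulrDl lerD//.
  by rewrite ler_wpM2l// prod_normE le_max lexx.
by rewrite ler_wpM2l// prod_normE le_max lexx orbT.
Qed.

(** Choose one point [rep t] of the class in each cell [t] that the class meets.
   A point of the class is close to [rep t + u] for its cell [t] and an integer
   vector [u], and [u] stabilises the class, so the functional vanishes at
   [u]. *)
Let phi_component p q : (forall w, stab w -> phi p q w = 0) ->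
  exists B, forall w, C z w -> `|phi p q w| <= B.
Proof.
move=> phi0; have [T [cell cellP]] := cells d_gt0.
have /choice[rep repP] : forall t, exists r,
    (exists2 w, C z w & cell w = t) -> C z r /\ cell r = t.
  move=> t; have [[w Cw cw]|no] := pselect (exists2 w, C z w & cell w = t).
    by exists w.
  by exists z.
exists (\sum_t `|phi p q (rep t)| + (`|p| + `|q|) * d) => w Cw.
have [Cr cr] : C z (rep (cell w)) /\ cell (rep (cell w)) = cell w.
  by apply: repP; exists w.
set r := rep (cell w) in Cr cr *.
have [u iu rw] := cellP _ _ cr.
have su : stab u.
  split=> //; apply: (C_trans Cw); apply: C_sym.
  apply: C_trans (C_shift iu Cr) _; apply: chained1; split.
  - exact/U_per/C_in/Cr.
  - exact: C_in Cw.
  - by rewrite opprD addrA.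
have -> : w = r + u + (w - r - u) by rewrite -[_ - _ - u]addrA -opprD [RHS]addrC subrK.
rewrite phiD (phiD _ _ r) (phi0 _ su) addr0 (le_trans (ler_normD _ _))// lerD//.
  rewrite (bigD1 (cell w)) //= lerDl; apply: sumr_ge0 => *; exact: normr_ge0.
by rewrite (le_trans (phi_le _ _ _))// ler_wpM2l ?addr_ge0// ltW.
Qed.

(** The point [iter (k * j) F z - v *+ j] stays in the class of [z], where the
    functional is bounded; its value there grows like [j] times the difference
    of the values at [k *: (a, b)] and at [v].  That difference is therefore
    zero, which is a rational relation between [1], [a] and [b]. *)
Lemma functional_on_stabiliser p q : p \is a Num.int -> q \is a Num.int ->
  (forall w, int_vec w -> C z (z + w) -> p * w.1 + q * w.2 = 0) ->
  p = 0 /\ q = 0.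
Proof.
move=> ip iq phi0.
have [B hB] : exists B, forall w, C z w -> `|phi p q w| <= B.
  by apply: phi_component => w [? ?]; exact: phi0.
have B0 : 0 <= B := le_trans (normr_ge0 _) (hB z (chained0 _ _)).
pose c := k%:R * phi p q (a, b) - phi p q v.
have c0 : c = 0.
  apply/eqP/contraT => cn0; have nc : 0 < `|c| by rewrite normr_gt0.
  (* The rate [e] below makes the error term at time [k * j] at most
     [`|c| * j / 2]. *)
  pose L := `|p| + `|q|.
  have L0 : 0 <= L by rewrite addr_ge0.
  have kR : 0 < k%:R :> R by rewrite ltr0n.
  have den : 0 < 2 * (L * k%:R + 1) by rewrite mulr_gt0// ltr_wpDl// mulr_ge0// ltW.
  have [N hN] := F_rot (divr_gt0 nc den).
  set e := `|c| / _ in hN.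
  pose j := (N + (Num.trunc (2 * (B + `|phi p q z|) / `|c|)).+1)%N.
  have jN : (N <= k * j)%N by apply: leq_trans (leq_addr _ _) _; exact: leq_pmull.
  have jB : 2 * (B + `|phi p q z|) < `|c| * j%:R.
    rewrite [X in _ < X]mulrC -ltr_pdivrMr//; apply: (lt_le_trans (truncnS_gt _)).
    by rewrite ler_nat leq_addl.
  set x := iter (k * j) F z.
  have Cx : C z (x - v *+ j).
    have := C_shift (int_vecN (int_vecMn j iv)) (C_iterk j).
    by rewrite addrK => /C_sym.
  have := hN (k * j)%N z jN; rewrite -/x; set err := x - z - _ => herr.
  have E : phi p q (x - v *+ j) = phi p q z + j%:R * c + phi p q err.
    rewrite /c /err /phi -[v *+ j]scaler_nat /= natrM; rewrite /GRing.scale /=; ring.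
  have L1 := hB _ Cx; rewrite E in L1.
  have L2 : `|phi p q err| <= L * (e * (k * j)%:R).
    by rewrite (le_trans (phi_le _ _ _))// ler_wpM2l.
  have L3 : L * (e * (k * j)%:R) <= `|c| * j%:R / 2.
    rewrite natrM.
    have -> : L * (e * (k%:R * j%:R)) = `|c| * j%:R / 2 * (L * k%:R / (L * k%:R + 1)).
      rewrite /e; field; lra.
    have Lk : 0 <= L * k%:R by rewrite mulr_ge0// ltW.
    by apply: ler_piMr; [rewrite !mulr_ge0|rewrite ler_pdivrMr; lra].
  have L4 : `|c| * j%:R <= B + `|phi p q z| + `|phi p q err|.
    have -> : `|c| * j%:R = `|j%:R * c| by rewrite normrM mulrC normr_nat.
    have -> : j%:R * c = (phi p q z + j%:R * c + phi p q err)
        - phi p q z - phi p q err by ring.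
    by rewrite (le_trans (ler_normB _ _))// lerD// (le_trans (ler_normB _ _))// lerD.
  lra.
have [m pm] := intrP ip; have [n qn] := intrP iq.
have /andP[/intrP[v1 vE1] /intrP[v2 vE2]] := iv.
have [|_ q0 r0] := @irr (- (m * v1 + n * v2))%:~R (k%:Z * m)%:~R (k%:Z * n)%:~R.
  rewrite !ratr_int intrN intrD !intrM -pm -qn -vE1 -vE2 -pmulrn.
  by rewrite -[RHS]c0 /c /phi /=; ring.
split.
- move/eqP: q0; rewrite intr_eq0 mulf_eq0 => /orP[|/eqP m0].
    by move=> /eqP[k0]; move: k_gt0; rewrite k0.
  by rewrite pm m0.
- move/eqP: r0; rewrite intr_eq0 mulf_eq0 => /orP[|/eqP m0].
    by move=> /eqP[k0]; move: k_gt0; rewrite k0.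
  by rewrite qn m0.
Qed.

(** By [functional_on_stabiliser] neither the first coordinate nor the
    determinant against a fixed [w1] vanishes on the stabiliser of the class,
    so it contains two independent vectors; Cramer's rule then gives multiples
    of the two basis vectors. *)
Lemma component_doubly_periodic : exists M : nat, [/\ (0 < M)%N,
  C z (z + (M%:R, 0)) & C z (z + (0, M%:R))].
Proof.
have [w1 [s1 n1]] : exists w, stab w /\ w.1 != 0.
  apply: contrapT => no.
  have [] := @functional_on_stabiliser 1 0; rewrite ?rpred1 ?rpred0//.
    move=> w iw Cw; rewrite mul1r mul0r addr0.
    by apply/eqP/contraT => w0; case: no; exists w.
  by move/eqP; rewrite oner_eq0.
have /andP[i11 i12] := s1.1.
have [w2 [s2 n2]] : exists w, stab w /\ w1.1 * w.2 - w1.2 * w.1 != 0.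
  apply: contrapT => no.
  have [] := @functional_on_stabiliser (- w1.2) w1.1; rewrite ?rpredN//.
    move=> w iw Cw; apply/eqP/contraT => w0; case: no; exists w; split=> //.
    by apply: contraNneq w0 => w0; rewrite mulNr addrC w0.
  by move=> _ w10; rewrite w10 eqxx in n1.
have /andP[i21 i22] := s2.1.
set D := _ - _ in n2.
have sD1 : stab (D, 0).
  have -> : (D, 0) = w2.2 *: w1 - w1.2 *: w2.
    by congr pair; rewrite /D /= /GRing.scale /=; ring.
  by apply: stabD; [exact: stabZ|exact/stabN/stabZ].
have sD2 : stab (0, D).
  have -> : (0, D) = w1.1 *: w2 - w2.1 *: w1.
    by congr pair; rewrite /D /= /GRing.scale /=; ring.
  by apply: stabD; [exact: stabZ|exact/stabN/stabZ].
have /intrP[m Dm] : D \is a Num.int by rewrite rpredB// rpredM.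
have m0 : m != 0 by apply: contraNneq n2 => m0; rewrite Dm m0.
exists `|m|%N; split; first by rewrite absz_gt0.
- case: m Dm m0 => n Dm _; first by rewrite /= pmulrn -Dm; case: sD1.
  have -> : (`|Negz n|%:R, 0) = - (D, 0) :> R * R.
    by rewrite Dm NegzE mulrNz; congr pair; rewrite /= ?opprK ?oppr0.
  by case: (stabN sD1).
- case: m Dm m0 => n Dm _; first by rewrite /= pmulrn -Dm; case: sD2.
  have -> : (0, `|Negz n|%:R) = - (0, D) :> R * R.
    by rewrite Dm NegzE mulrNz; congr pair; rewrite /= ?opprK ?oppr0.
  by case: (stabN sD2).
Qed.

End Absorbed.

(** * Totally irrational rotation excludes attractors *)

Section NoAttractor.
Variable R : realType.
Implicit Types (F G : R * R -> R * R) (U : set (R * R)) (z w v : R * R).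

Definition commutes_Z2 F := forall z v, int_vec v -> F (z + v) = F z + v.

Definition unif_cont F := forall e, 0 < e -> exists2 d, 0 < d &
  forall z w, `|z - w| < d -> `|F z - F w| < e.

Definition rotates_by (r : R * R) F := forall e, 0 < e -> exists N, forall n z,
  (N <= n)%N -> `|iter n F z - z - n%:R *: r| <= e * n%:R.

Lemma link_chain_in U d n (c : nat -> R * R) : U (c 0%N) ->
  (forall i, (i < n)%N -> link U d (c i) (c i.+1)) ->
  forall i, (i <= n)%N -> U (c i).
Proof. by move=> U0 Ec [|i] // /Ec[]. Qed.

(** The chains are made with jumps so small that their images have jumps at
    most [e / 4]: two crossing image chains then come within [e / 2] of each
    other. *)
Lemma doubly_periodic_image F a b e U : 0 < e ->
  commutes_Z2 F -> unif_cont F -> rotates_by (a, b) F ->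
  rationally_independent a b ->
  (forall z v, int_vec v -> U z -> U (z + v)) ->
  (forall z w, U z -> `|w - F z| < e -> U w) -> U !=set0 ->
  exists (M : nat) n m (p q : nat -> R * R), [/\ (0 < M)%N,
    (forall i, (i <= n)%N -> U (p i)), (forall j, (j <= m)%N -> U (q j)),
    (forall i, (i < n)%N -> `|F (p i.+1) - F (p i)| <= e / 4) /\
    (forall j, (j < m)%N -> `|F (q j.+1) - F (q j)| <= e / 4) &
    F (p n) = F (p 0%N) + (M%:R, 0) /\ F (q m) = F (q 0%N) + (0, M%:R)].
Proof.
move=> e0 Fper Fuc Frot irr Uper Uabs [z0 Uz0].
have e4 : 0 < e / 4 by rewrite divr_gt0.
have [d d0 dP] := Fuc _ e4.
have dP' z w : `|z - w| < d -> `|F z - F w| < e.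
  by move=> /dP h; apply: lt_le_trans h _; lra.
have [z [k [v [Uz k0 iv Cz]]]] :=
  component_returns Uper Uabs d0 dP' Uz0.
have [M [M0 [n [p [p0 pn Ep]]] [m [q [q0 qm Eq]]]]] :=
  component_doubly_periodic Fper Frot irr Uper Uabs d0 dP' Uz k0 iv Cz.
exists M, n, m, p, q; split=> //.
- by apply: link_chain_in Ep; rewrite p0.
- by apply: link_chain_in Eq; rewrite q0.
- by split=> i => [/Ep|/Eq] [_ _ /dP/ltW].
- rewrite pn qm p0 q0 !Fper //; first by rewrite /int_vec /= natr_int rpred0.
  by rewrite /int_vec /= natr_int rpred0.
Qed.

(** If [y] were outside [U], the set [W] of points at distance less than [e]
    from the complement of [U] would be absorbed by [G] as [U] is by [F]: if
    [G w] were in [U], all points near [w = F (G w)] would be in [U].  The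
    resulting chains cross, and the point of [G W] at the crossing is outside
    [U] although it is near a point of [F U]. *)
Theorem absorbed_set_full F G a b e U : 0 < e -> cancel G F ->
  commutes_Z2 F -> unif_cont F -> rotates_by (a, b) F ->
  commutes_Z2 G -> unif_cont G -> rotates_by (- (a, b)) G ->
  rationally_independent a b ->
  (forall z v, int_vec v -> U z -> U (z + v)) ->
  (forall z w, U z -> `|w - F z| < e -> U w) -> U !=set0 ->
  forall z, U z.
Proof.
move=> e0 GK Fper Fuc Frot Gper Guc Grot irr Uper Uabs Un0 y.
apply: contrapT => nUy.
pose W := [set w | exists2 k, ~ U k & `|w - k| < e].
have GW w : W w -> ~ U (G w).
  move=> [k nUk wk] UGw; apply/nUk/(Uabs _ _ UGw).
  by rewrite GK distrC.
have Wper z v : int_vec v -> W z -> W (z + v).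
  move=> iv [k nUk zk]; exists (k + v).
    by move=> /(Uper _ _ (int_vecN iv)); rewrite addrK.
  by rewrite opprD addrACA subrr addr0.
have Wabs z w : W z -> `|w - G z| < e -> W w.
  by move=> Wz zw; exists (G z) => //; exact: GW.
have Wn0 : W !=set0 by exists y, y => //; rewrite subrr normr0.
have irrN : rationally_independent (- a) (- b).
  move=> p q r E; have [|-> /eqP + /eqP] := irr p (- q) (- r).
  - by rewrite !rmorphN !mulNr -!mulrN.
  - by rewrite !oppr_eq0 => /eqP-> /eqP->.
have [M [n [_ [p [_ [M0 Up _ [dp _] [pn _]]]]]]] :=
  doubly_periodic_image e0 Fper Fuc Frot irr Uper Uabs Un0.
have [M' [_ [m [_ [q [M'0 _ Wq [_ dq] [_ qm]]]]]]] :=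
  doubly_periodic_image e0 Gper Guc Grot irrN Wper Wabs Wn0.
have [i [j [v [lein lejm iv close]]]] :=
  periodic_chains_cross M0 M'0 dp dq pn qm.
apply: (GW _ (Wq _ lejm)).
rewrite -(subrK v (G (q j))); apply: (Uper _ _ iv); apply: (Uabs _ _ (Up _ lein)).
rewrite distrC opprB addrA addrAC; apply: le_lt_trans close _; lra.
Qed.

End NoAttractor.

(** * Lifts whose rotation set is a point *)

Section Lifts.
Variable R : realType.
Implicit Types (F G H : R * R -> R * R) (z w v : R * R).

Lemma continuous_eps F z e : continuous F -> 0 < e ->
  exists2 d, 0 < d & forall w, `|w - z| < d -> `|F w - F z| < e.
Proof.
move=> cF e0; have /cvgrPdist_lt/(_ e e0) := cF z.
rewrite -nbhs_nearE -nbhs_ballE => -[d /= d0 dP]; exists d => // w wz.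
by rewrite distrC; apply: dP; rewrite -ball_normE /= distrC.
Qed.

Lemma continuous_segment z w : continuous (fun t : R => z + t *: w).
Proof.
move=> t; apply: cvgD; first exact: cvg_cst.
exact: scalel_continuous.
Qed.

(** Along a segment such a function would take a value half-way between two
    consecutive integers. *)
Lemma continuous_int_cst (g : R * R -> R) : continuous g ->
  (forall z, g z \is a Num.int) -> forall z w, g z = g w.
Proof.
move=> cg ig.
suff H z w : ~ (g z < g w).
  by move=> z w; have [||//] := ltgtP (g z) (g w) => /H.
move=> lt.
have step : g z + 1 <= g w.
  have /intrP[m zm] := ig z; have /intrP[n wn] := ig w.
  by move: lt; rewrite zm wn ltr_int -lezD1 -(ler_int R) intrD.
pose h (t : R) := g (z + t *: (w - z)).
have ch : continuous h.
  move=> t; apply: continuous_comp; last exact: cg.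
  exact: continuous_segment.
have h0 : h 0 = g z by rewrite /h scale0r addr0.
have h1 : h 1 = g w by rewrite /h scale1r addrC subrK.
have [||c _ hc] := @IVT R h 0 1 (g z + 2^-1) ler01.
- exact: continuous_subspaceT.
- rewrite h0 h1 min_l ?max_r; lra.
have /intrP[m hm] := ig (z + c *: (w - z)); have /intrP[n gn] := ig z.
move: hc; rewrite /h hm gn => E.
have : (2 * (m - n))%:~R = 1%:~R :> R by rewrite intrM rmorphB /= E; lra.
by move=> /intr_inj; lia.
Qed.

(** The existence of cluster points in a form that provides subsequences. *)
Lemma seq_cluster (V : normedModType R) (A : set V) (u : nat -> V) :
  compact A -> (forall i, A (u i)) ->
  exists p, forall e N, 0 < e -> exists2 n, (N <= n)%N & `|u n - p| < e.
Proof.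
move=> cA Au; have [|p [_ up]] := cA (u @ \oo) _; first by exists 0%N => // n _.
exists p => e N e0.
have [x [[n Nn <-] pe]] : ([set u n | n in [set n | (N <= n)%N]] `&` ball p e) !=set0.
  by apply: up; [exists N => // n Nn; exists n|exact: nbhsx_ballx].
by exists n => //; move: pe; rewrite -ball_normE /= distrC.
Qed.

Lemma norm_box_compact M : compact [set z : R * R | `|z| <= M].
Proof.
rewrite (_ : mkset _ = `[-M, M] `*` `[-M, M]).
  by apply: compact_setX; exact: segment_compact.
apply/seteqP; split=> z /=; rewrite norm_pair_le !in_itv /= !ler_norml.
  by move=> /andP[].
by move=> [-> ->].
Qed.

Definition floor_vec z : R * R := ((Num.floor z.1)%:~R, (Num.floor z.2)%:~R).

Lemma floor_vec_int z : int_vec (floor_vec z).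
Proof. by rewrite /int_vec /= !intr_int. Qed.

Lemma floor_vec_le z : `|z - floor_vec z| <= 1.
Proof.
have fl1 (x : R) : `|x - (Num.floor x)%:~R| <= 1.
  by have := floor_itv x; rewrite intrD ler_norml => /andP[? ?]; apply/andP; split; lra.
by rewrite norm_pair_le /= !fl1.
Qed.

(** The property of [H] of inducing a map of the torus. *)
Definition int_lift H := forall z v, int_vec v -> int_vec (H (z + v) - H z).

Lemma int_lift_iter F n : int_lift F -> int_lift (iter n F).
Proof.
move=> iF z v iv; elim: n => [|n IH] /=; first by rewrite addrC addKr.
by have := iF (iter n F z) _ IH; rewrite [_ + (_ - _)]addrC subrK.
Qed.

Lemma continuous_iter F n : continuous F -> continuous (iter n F).
Proof.
move=> cF; elim: n => [|n IH] /=; first by move=> x; exact: cvg_id.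
by move=> x; apply: continuous_comp; [exact: IH|exact: cF].
Qed.

Lemma int_lift_cst H v : continuous H -> int_lift H -> int_vec v ->
  forall z w, H (z + v) - H z = H (w + v) - H w.
Proof.
move=> cH iH iv z w.
have cg : continuous (fun z => H (z + v) - H z).
  have cv : continuous (fun z => H (z + v)).
    move=> x; apply: (@continuous_comp (R * R)%type (R * R)%type (R * R)%type (fun y => y + v) H); last exact: cH.
    by apply: cvgD; [exact: cvg_id|exact: cvg_cst].
  by move=> x; apply: cvgB; [exact: cv|exact: cH].
have c1 : continuous (fun z => (H (z + v) - H z).1).
  move=> x; apply: (@continuous_comp (R * R)%type (R * R)%type R
    (fun z => H (z + v) - H z) fst); first exact: cg.
  exact: cvg_fst.
have c2 : continuous (fun z => (H (z + v) - H z).2).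
  move=> x; apply: (@continuous_comp (R * R)%type (R * R)%type R
    (fun z => H (z + v) - H z) snd); first exact: cg.
  exact: cvg_snd.
have i1 x : (H (x + v) - H x).1 \is a Num.int by case/andP: (iH x v iv).
have i2 x : (H (x + v) - H x).2 \is a Num.int by case/andP: (iH x v iv).
rewrite [LHS]surjective_pairing [RHS]surjective_pairing.
by rewrite (continuous_int_cst c1 i1 z w) (continuous_int_cst c2 i2 z w).
Qed.

Definition mean_disp F n z : R * R := n%:R^-1 *: (iter n F z - z).

(** A sequence of mean displacements in the annulus, of orders tending to
    infinity, would have a cluster point there, and this cluster point is a
    rotation vector other than [r]. *)
Lemma mean_disp_annulus F r e M : rotation_set F = [set r] -> 0 < e ->
  exists N, forall n z, (N <= n)%N ->
    `|mean_disp F n z - r| < e \/ M < `|mean_disp F n z - r|.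
Proof.
move=> rotF e0; apply: contrapT => no.
have /choice[nz nzP] : forall N, exists nz : nat * (R * R), (N <= nz.1)%N /\
    e <= `|mean_disp F nz.1 nz.2 - r| <= M.
  move=> N; apply: contrapT => noN; apply: no; exists N => n z Nn.
  have [|le1] := ltP `|mean_disp F n z - r| e; first by left.
  have [|le2] := ltP M `|mean_disp F n z - r|; first by right.
  by case: noN; exists (n, z); rewrite /= le1 le2.
pose u i := mean_disp F (nz i).1 (nz i).2 - r.
have [|p pP] := @seq_cluster _ _ u (@norm_box_compact M).
  by move=> i; have [_ /andP[]] := nzP i.
have /choice[s sP] : forall i, exists n, (i <= n)%N /\ `|u n - p| < i.+1%:R^-1.
  by move=> i; have [|n] := pP i.+1%:R^-1 i; [rewrite invr_gt0 ltr0n|exists n].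
have : rotation_set F (p + r).
  exists (fun i => (nz (s i)).1), (fun i => (nz (s i)).2); split.
    apply/cvgnyPge => A; exists A => // i /= Ai.
    have [le1 _] := nzP (s i); have [le2 _] := sP i.
    exact: leq_trans Ai (leq_trans le2 le1).
  apply/cvgrPdist_lt => d d0.
  have := near_infty_natSinv_lt (PosNum d0); apply: filterS => i /= lti.
  have [_ lt] := sP i; apply: lt_trans lti; apply: le_lt_trans lt.
  by rewrite /u distrC opprD addrA addrAC.
rewrite rotF /= => /eqP; rewrite eq_sym -subr_eq subrr eq_sym => /eqP p0.
have [i _ /(_ i (leqnn i)) /= ei] := near_infty_natSinv_lt (PosNum e0).
have [_ lt] := sP i; have [_ /andP[le _]] := nzP (s i).
by move: lt; rewrite p0 subr0 /u => lt; have := lt_trans (le_lt_trans le lt) ei; rewrite ltxx.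
Qed.

Lemma sphere_crossing (h : R -> R * R) t : continuous h -> 0 <= t ->
  `|h 0| < 1 -> 1 < `|h t| -> exists s, `|h s| = 1.
Proof.
move=> ch t0 h0 ht.
have [||c _ hc] := @IVT R (fun s => `|h s|) 0 t 1 t0; last by exists c.
  apply: continuous_subspaceT => s.
  by apply: continuous_comp; [exact: ch|exact: norm_continuous].
rewrite min_l ?max_r; last 2 first.
- exact: ltW (lt_trans h0 ht).
- exact: ltW (lt_trans h0 ht).
by rewrite (ltW h0) (ltW ht).
Qed.

(** If [iter n F] translates by [S] different from [v] when its argument is
    translated by [v], the mean displacement at [z + v *+ k] is arbitrarily far
    from [r] for large [k].  On the way from [z] it crosses the unit circle
    around [r], which [mean_disp_annulus] excludes for large [n]. *)
Lemma iter_fixes_lattice F r : continuous F -> int_lift F ->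
  rotation_set F = [set r] ->
  exists N, forall n z v, (N <= n)%N -> `|mean_disp F n z - r| < 1 ->
    int_vec v -> iter n F v - iter n F 0 = v.
Proof.
move=> cF iF rotF; have [N NP] := mean_disp_annulus 1 rotF ltr01.
exists N.+1 => n z v ltNn zr iv; apply/eqP/contraT => nev.
set S := iter n F v - iter n F 0 in nev.
have n0 : 0 < n%:R :> R by rewrite ltr0n (leq_ltn_trans _ ltNn).
have SP x : iter n F (x + v) = iter n F x + S.
  have := int_lift_cst (@continuous_iter F n cF) (@int_lift_iter F n iF) iv x 0.
  by rewrite add0r -/S => <-; rewrite [RHS]addrC subrK.
clearbody S.
have SPk k x : iter n F (x + v *+ k) = iter n F x + S *+ k.
  elim: k => [|k IH]; first by rewrite !mulr0n !addr0.
  by rewrite !mulrSr !addrA SP IH.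
have Sv0 : 0 < `|S - v| by rewrite normr_gt0 subr_eq0.
pose k := (Num.trunc (2 * n%:R / `|S - v|)).+1.
have kP : 2 * n%:R < k%:R * `|S - v|.
  by rewrite -ltr_pdivrMr// truncnS_gt.
pose h (t : R) := mean_disp F n (z + t *: (v *+ k)) - r.
have ch : continuous h.
  have cs : continuous (fun t : R => z + t *: (v *+ k)).
    exact: continuous_segment.
  have cn : continuous (fun t : R => iter n F (z + t *: (v *+ k))).
    move=> t; apply: (@continuous_comp R (R * R)%type (R * R)%type
      (fun t => z + t *: (v *+ k)) (iter n F)); first exact: cs.
    exact: continuous_iter.
  move=> t; apply: cvgB; last exact: cvg_cst.
  apply: (@continuous_comp R (R * R)%type (R * R)%type (fun t =>
    iter n F (z + t *: (v *+ k)) - (z + t *: (v *+ k))) ( *:%R n%:R^-1)).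
    by apply: cvgB; [exact: cn|exact: cs].
  exact: scaler_continuous.
have [||s hs] := sphere_crossing ch ler01.
- by rewrite /h scale0r addr0.
- rewrite /h scale1r /mean_disp SPk.
  have -> : iter n F z + S *+ k - (z + v *+ k) = iter n F z - z + (S - v) *+ k.
    by rewrite opprD addrACA mulrnBl.
  rewrite scalerDr addrAC -/(mean_disp F n z).
  have : 2 < `|n%:R^-1 *: ((S - v) *+ k)|.
    rewrite -[(S - v) *+ k]scaler_nat !normrZ ger0_norm ?invr_ge0 ?ltW//.
    by rewrite normr_nat mulrC ltr_pdivlMr.
  have := lerB_normD (n%:R^-1 *: ((S - v) *+ k)) (mean_disp F n z - r).
  move=> tri big; rewrite addrC; apply: lt_le_trans tri.
  rewrite ltrBrDr; apply: lt_trans big; lra.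
by have [] := NP n (z + s *: (v *+ k)) (ltnW ltNn); rewrite -/(h s) hs ltxx.
Qed.

Lemma mean_disp_close F r e N : rotation_set F = [set r] -> 0 < e ->
  exists n z, (N <= n)%N /\ `|mean_disp F n z - r| < e.
Proof.
move=> rotF e0; have : rotation_set F r by rewrite rotF.
move=> [n [z [/cvgnyPge/(_ N) nN /cvgrPdist_lt/(_ e e0) zr]]].
have [i [/= iN ir]] := filter_ex (filterI nN zr).
by exists (n i), (z i); rewrite distrC.
Qed.

Lemma displacement_bounded F : continuous F ->
  exists B, forall z, `|z| <= 1 -> `|F z - z| <= B.
Proof.
move=> cF.
have [|||c _ cP] := @compact_EVT_max _ R (fun z => `|F z - z|)
    [set z : R * R | `|z| <= 1].
- by exists 0; rewrite /= normr0.
- exact: norm_box_compact.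
- apply: continuous_subspaceT => z.
  by apply: cvg_norm; apply: cvgB; [exact: cF|exact: cvg_id].
by exists `|F c - c| => z z1; apply: cP; rewrite inE.
Qed.

(** [iter_fixes_lattice] is used at two consecutive times: if [iter n F] and
    [iter n.+1 F] both commute with integer translations, so does [F].  For [n] a
    time with a mean displacement near [r] at a point [y], translate [y] by an
    integer vector to a point [w] whose [n]-th image is in the unit square; one
    more iteration then moves it by a bounded amount, so that the mean
    displacement of [w] at time [n.+1] is again near [r]. *)
Lemma lift_commutes F r : continuous F -> int_lift F ->
  rotation_set F = [set r] -> commutes_Z2 F.
Proof.
move=> cF iF rotF z v iv.
have [N NP] := iter_fixes_lattice cF iF rotF.
have [B BP] := displacement_bounded cF.
have half : 0 < 2^-1 :> R by rewrite invr_gt0.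
have B0 : 0 <= B by apply: le_trans (normr_ge0 _) (BP 0 _); rewrite normr0.
pose K := (N + (Num.trunc (2 * (B + `|r|))).+1)%N.
have [n [y [Kn yr]]] := mean_disp_close K rotF half.
have Nn : (N <= n)%N := leq_trans (leq_addr _ _) Kn.
have nB : 2 * (B + `|r|) < n%:R.
  apply: lt_le_trans (truncnS_gt _) _; rewrite ler_nat.
  exact: leq_trans (leq_addl _ _) Kn.
have n0 : 0 < n%:R :> R by apply: le_lt_trans nB; rewrite mulr_ge0// addr_ge0.
have fixn u : int_vec u -> iter n F u - iter n F 0 = u.
  by apply: (NP n y) => //; lra.
pose u := floor_vec (iter n F y); pose w := y - u.
have iu : int_vec (- u) by apply/int_vecN/floor_vec_int.
have Fw : iter n F w = iter n F y - u.
  have := int_lift_cst (@continuous_iter F n cF) (@int_lift_iter F n iF) iu y 0.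
  by rewrite add0r fixn// => /eqP; rewrite subr_eq => /eqP ->; rewrite addrC.
have close : `|mean_disp F n.+1 w - r| < 1.
  have n10 : 0 < n.+1%:R :> R by rewrite ltr0n.
  have E : F (iter n F w) - w - n.+1%:R *: r =
      F (iter n F w) - iter n F w - r + n%:R *: (mean_disp F n y - r).
    rewrite /mean_disp scalerBr scalerA divff ?gt_eqF// scale1r.
    move: (F (iter n F w)) => x; rewrite Fw /w -natr1 scalerDl scale1r.
    rewrite [LHS]surjective_pairing [RHS]surjective_pairing.
    by congr pair; rewrite /=; ring.
  have -> : mean_disp F n.+1 w - r =
      n.+1%:R^-1 *: (F (iter n F w) - w - n.+1%:R *: r).
    by rewrite scalerBr scalerA mulVf ?gt_eqF// scale1r.
  rewrite normrZ ger0_norm ?invr_ge0 ?ltW// mulrC ltr_pdivrMr// mul1r E.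
  have y1 : `|iter n F w| <= 1 by rewrite Fw; exact: floor_vec_le.
  apply: le_lt_trans (ler_normD _ _) _; rewrite normrZ normr_nat.
  have := ler_normB (F (iter n F w) - iter n F w) r; have := BP _ y1.
  have : n%:R * `|mean_disp F n y - r| <= n%:R / 2.
    by rewrite ler_wpM2l ?ltW.
  rewrite -[n.+1%:R]natr1; lra.
have fixn1 x : int_vec x -> iter n.+1 F x - iter n.+1 F 0 = x.
  by apply: NP close; exact: leqW.
have := int_lift_cst cF iF iv z (iter n F 0).
have -> : iter n F 0 + v = iter n F v.
  by rewrite -[in LHS](fixn _ iv) addrC subrK.
by rewrite -!iterS fixn1// => /eqP; rewrite subr_eq => /eqP ->; rewrite addrC.
Qed.

End Lifts.

(** * Uniform estimates for the lift and its inverse *)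

Lemma subrDr (V : zmodType) (x y z : V) : x + z - (y + z) = x - y.
Proof. by rewrite opprD addrACA subrr addr0. Qed.

Lemma ltr_dist_add (R : realType) (y x z : R * R) (a b : R) :
  `|x - y| < a -> `|y - z| < b -> `|x - z| < a + b.
Proof. by move=> xy yz; apply: le_lt_trans (ler_distD y x z) (ltrD xy yz). Qed.

Section Inverse.
Variables (R : realType) (F G : R * R -> R * R).
Hypotheses (cF : continuous F) (Fper : commutes_Z2 F).
Implicit Types (z w v : R * R).

Lemma commuting_displacement_bounded : exists B, forall z, `|F z - z| <= B.
Proof.
have [B BP] := displacement_bounded cF; exists B => z.
have := BP _ (floor_vec_le z).
by rewrite Fper ?int_vecN ?floor_vec_int// opprD addrACA opprK addNr addr0.
Qed.

(** Mean displacements are bounded by the displacement of [F], so the outer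
    alternative of [mean_disp_annulus] does not occur. *)
Lemma rotates_by_rotation_set r : rotation_set F = [set r] -> rotates_by r F.
Proof.
move=> rotF e e0.
have [B BP] := commuting_displacement_bounded.
have [N NP] := mean_disp_annulus (B + `|r|) rotF e0.
have iterB n z : `|iter n F z - z| <= n%:R * B.
  elim: n => [|n IH]; first by rewrite subrr normr0 mul0r.
  rewrite -natr1 mulrDl mul1r [X in _ <= X]addrC.
  have -> : iter n.+1 F z - z =
      F (iter n F z) - iter n F z + (iter n F z - z) by rewrite addrA subrK.
  by apply: le_trans (ler_normD _ _) _; rewrite lerD.
exists N.+1 => n z ltNn.
have n0 : 0 < n%:R :> R by rewrite ltr0n (leq_ltn_trans _ ltNn).
have E : iter n F z - z - n%:R *: r = n%:R *: (mean_disp F n z - r).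
  by rewrite scalerBr scalerA divff ?gt_eqF// scale1r.
rewrite E normrZ normr_nat mulrC ler_pM2r//.
have [/ltW//|] := NP n z (ltnW ltNn).
rewrite ltNge; case/negP; apply: le_trans (ler_normB _ _) _.
by rewrite lerD2r /mean_disp normrZ normfV normr_nat ler_pdivrMl.
Qed.

(** Integer translations bring any two close points near the unit square,
    where compactness applies. *)
Lemma uniformly_continuous : unif_cont F.
Proof.
move=> e e0; apply: contrapT => no.
have /choice[zw zwP] : forall i : nat, exists zw : (R * R) * (R * R),
    [/\ `|zw.1| <= 1, `|zw.1 - zw.2| < i.+1%:R^-1 & e <= `|F zw.1 - F zw.2|].
  move=> i; apply: contrapT => noi; apply: no.
  exists i.+1%:R^-1; first by rewrite invr_gt0 ltr0n.
  move=> z w zw; rewrite ltNge; apply/negP => le; apply: noi.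
  exists (z - floor_vec z, w - floor_vec z) => /=.
  have ifl := int_vecN (floor_vec_int z).
  rewrite (Fper z ifl) (Fper w ifl) !subrDr; split=> //.
  exact: floor_vec_le.
have [p pP] : exists p : R * R, forall d N, 0 < d ->
    exists2 n, (N <= n)%N & `|(zw n).1 - p| < d.
  apply: (seq_cluster (@norm_box_compact R 1)) => i.
  by have [] := zwP i.
have e2 : 0 < e / 2 by rewrite divr_gt0.
have [d d0 dP] := continuous_eps p cF e2.
have d2 : 0 < d / 2 by rewrite divr_gt0.
have [N _ NP] := near_infty_natSinv_lt (PosNum d2).
have [n Nn np] := pP _ N d2; have nd : n.+1%:R^-1 < d / 2 := NP n Nn.
have [_ zwn] := zwP n; apply/negP; rewrite -ltNge.
have d2d : d / 2 < d by lra.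
have z1 : `|F (zw n).1 - F p| < e / 2 by apply/dP/(lt_trans np).
have w1 : `|F (zw n).2 - F p| < e / 2.
  apply: dP; rewrite (splitr d); apply: ltr_dist_add np.
  by rewrite distrC; exact: lt_trans zwn nd.
by rewrite (splitr e); apply: ltr_dist_add z1 _; rewrite distrC.
Qed.

Hypotheses (FK : cancel F G) (GK : cancel G F).

Lemma inverse_commutes : commutes_Z2 G.
Proof. by move=> z v iv; apply: (can_inj FK); rewrite Fper// !GK. Qed.

(** An orbit of [G] is an orbit of [F] read backwards. *)
Lemma inverse_rotates_by r : rotates_by r F -> rotates_by (- r) G.
Proof.
move=> Frot e /Frot[N NP]; exists N => n z Nn.
have Kn : iter n F (iter n G z) = z.
  by elim: (n) => // k IH; rewrite iterSr (iterS k G) GK.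
have := NP n (iter n G z) Nn; rewrite Kn -normrN.
by rewrite opprB [- (z - _)]opprB scalerN opprK addrC.
Qed.

(** Points [x], [y] with close images stay at bounded distance, because [F]
    has bounded displacement.  If their distance did not tend to zero with that
    of their images, a cluster point would be a pair of distinct points with
    the same image. *)
Lemma inverse_uniformly_continuous : unif_cont G.
Proof.
have [B BP] := commuting_displacement_bounded.
move=> e e0; apply: contrapT => no.
have /choice[xy xyP] : forall i : nat, exists xy : (R * R) * (R * R),
    [/\ `|xy.1| <= 1, `|F xy.1 - F xy.2| < i.+1%:R^-1 & e <= `|xy.1 - xy.2|].
  move=> i; apply: contrapT => noi; apply: no.
  exists i.+1%:R^-1; first by rewrite invr_gt0 ltr0n.
  move=> z w zw; rewrite ltNge; apply/negP => le; apply: noi.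
  exists (G z - floor_vec (G z), G w - floor_vec (G z)) => /=.
  have ifl := int_vecN (floor_vec_int (G z)).
  rewrite (Fper (G z) ifl) (Fper (G w) ifl) !GK !subrDr; split=> //.
  exact: floor_vec_le.
pose A : set ((R * R) * (R * R)) :=
  [set z | `|z| <= 1] `*` [set z | `|z| <= 2 * B + 2].
have cA : compact A by apply: compact_setX; exact: norm_box_compact.
have [p pP] : exists p : (R * R) * (R * R), forall d N, 0 < d ->
    exists2 n, (N <= n)%N & `|xy n - p| < d.
  apply: (seq_cluster cA) => i; have [x1 d1 _] := xyP i; split=> //=.
  have i1 : i.+1%:R^-1 <= 1 :> R by rewrite invf_le1 ?ltr0n// ler1n.
  have Bx := BP (xy i).1; have By := BP (xy i).2.
  have -> : (xy i).2 = (xy i).1 + (F (xy i).1 - (xy i).1)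
      - (F (xy i).1 - F (xy i).2) - (F (xy i).2 - (xy i).2).
    by rewrite [(xy i).1 + _]addrC subrK !subKr.
  have -> : 2 * B + 2 = 1 + B + 1 + B by ring.
  apply: le_trans (ler_normB _ _) (lerD _ By).
  apply: le_trans (ler_normB _ _) (lerD _ (le_trans (ltW d1) i1)).
  exact: le_trans (ler_normD _ _) (lerD x1 Bx).
have Fp : F p.1 = F p.2.
  apply/eqP; rewrite -subr_eq0 -normr_le0 leNgt; apply/negP => a0.
  set a := `|_| in a0.
  have a3 : 0 < a / 3 by rewrite divr_gt0.
  have [d1 d10 dP1] := continuous_eps p.1 cF a3.
  have [d2 d20 dP2] := continuous_eps p.2 cF a3.
  have [N _ NP] := near_infty_natSinv_lt (PosNum a3).
  have m0 : 0 < Num.min d1 d2 by rewrite lt_min d10.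
  have [n Nn] := pP _ N m0; rewrite prod_normE gt_max !lt_min /=.
  move=> /andP[/andP[/dP1 x1 _] /andP[_ /dP2 y1]].
  have [_ xyn _] := xyP n; have na : n.+1%:R^-1 < a / 3 := NP n Nn.
  have : a < a / 3 + (a / 3 + a / 3).
    apply: (ltr_dist_add (y := F (xy n).1)); first by rewrite distrC.
    exact: ltr_dist_add (lt_trans xyn na) y1.
  lra.
have E := can_inj FK Fp.
have e2 : 0 < e / 2 by rewrite divr_gt0.
have [n _] := pP _ 0%N e2; rewrite prod_normE gt_max /= -E => /andP[x1 y1].
have [_ _] := xyP n; apply/negP; rewrite -ltNge.
by rewrite (splitr e); apply: ltr_dist_add x1 _; rewrite distrC.
Qed.

End Inverse.

(** * From the torus to the plane *)

Section TorusLifts.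
Variable R : realType.
Implicit Types (f : torus R -> torus R) (F : R * R -> R * R) (z w v : R * R).

Lemma torus_proj_surj (t : torus R) : exists z, torus_proj z = t.
Proof. by exists (repr t); exact: reprK. Qed.

Lemma torus_projD z v : int_vec v -> torus_proj (z + v) = torus_proj z.
Proof.
by move=> /andP[? ?]; apply/torus_projP; rewrite /= !(addrC z.1, addrC z.2) !addrK.
Qed.

Lemma torus_proj_eq z w : torus_proj z = torus_proj w -> int_vec (z - w).
Proof. by move=> /torus_projP[? ?]; apply/andP. Qed.

(** The factor [2] bounds the Euclidean norm by the sup norm of the plane. *)
Lemma torus_dist_le z w : torus_dist (torus_proj z) (torus_proj w) <= 2 * `|z - w|.
Proof.
apply: (@le_trans _ _ (eucl_dist z w)).
  apply: ge_inf; last by exists z, w.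
  by exists 0 => _ [? [? [_ _ ->]]]; exact: sqrtr_ge0.
have h0 : 0 <= 2 * `|z - w| by rewrite mulr_ge0.
rewrite -[leRHS]ger0_norm// -sqrtr_sqr; apply: ler_wsqrtr.
have sq (x m : R) : `|x| <= m -> x ^+ 2 <= m ^+ 2.
  by rewrite ler_norml => /andP[? ?]; nra.
have := lexx `|z - w|; rewrite {1}norm_pair_le /= => /andP[/sq h1 /sq h2].
by rewrite exprMn; have := sqr_ge0 `|z - w|; lra.
Qed.

Lemma lift_int_lift f F : is_lift f F -> int_lift F.
Proof.
by move=> [_ Ff] z v iv; apply: torus_proj_eq; rewrite !Ff torus_projD.
Qed.

Lemma lift_bijective f F : is_lift f F -> commutes_Z2 F -> bijective f ->
  exists2 G, cancel F G & cancel G F.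
Proof.
move=> [_ Ff] Fper [g fK gK].
have Finj : injective F.
  move=> z w E.
  have izw : int_vec (z - w).
    by apply/torus_proj_eq/(can_inj fK); rewrite -!Ff E.
  have := Fper w _ izw; rewrite addrC subrK E -[LHS]addr0.
  by move=> /addrI/esym/eqP; rewrite subr_eq0 => /eqP.
have Fsurj y : exists z, F z = y.
  have [z zP] := torus_proj_surj (g (torus_proj y)).
  have iy : int_vec (y - F z) by apply: torus_proj_eq; rewrite Ff zP gK.
  by exists (z + (y - F z)); rewrite Fper// addrC subrK.
have [G GK] := choice Fsurj; exists G => // z.
by apply: Finj; rewrite GK.
Qed.

End TorusLifts.

Theorem corollary1p2 (R : realType) (f : torus R -> torus R) :
  non_resonant f -> chain_transitive f.
Proof.
move=> [[[cf [g [cg fK gK]]] _] [F [a [b [Flift rotF irr]]]]] x y e e0.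
have [cF Ff] := Flift.
have Fper := lift_commutes cF (lift_int_lift Flift) rotF.
have [|G FK GK] := lift_bijective Flift Fper; first by exists g.
have Frot := rotates_by_rotation_set cF Fper rotF.
pose reach t := exists n s, [/\ (1 <= n)%N, s 0%N = x, s n = t &
  forall i, (i < n)%N -> torus_dist (s i.+1) (f (s i)) < e].
have reach_step z w : reach (torus_proj z) -> `|w - F z| < e / 2 ->
    reach (torus_proj w).
  move=> [n [s [n1 s0 sn sP]]] wz.
  exists n.+1, (fun i => if i == n.+1 then torus_proj w else s i).
  rewrite eqxx; split=> // i; rewrite ltnS eqSS => lein.
  rewrite (ltn_eqF (lein : (i < n.+1)%N)); case: eqP => [->|/eqP ne].
    by rewrite sn -Ff; apply: le_lt_trans (torus_dist_le _ _) _; lra.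
  by apply: sP; rewrite ltn_neqAle ne.
have e2 : 0 < e / 2 by rewrite divr_gt0.
have [y0 <-] := torus_proj_surj y.
apply: (absorbed_set_full (U := [set z | reach (torus_proj z)]) e2 GK Fper
  (uniformly_continuous cF Fper) Frot (inverse_commutes Fper FK GK)
  (inverse_uniformly_continuous cF Fper FK GK)
  (inverse_rotates_by GK Frot) irr).
- by move=> z v iv /=; rewrite torus_projD.
- exact: reach_step.
have [x0 x0P] := torus_proj_surj x.
exists (F x0), 1%N, (fun i => if i is 0%N then x else torus_proj (F x0)).
split=> // -[|i] // _; rewrite -x0P -Ff.
by apply: le_lt_trans (torus_dist_le _ _) _; rewrite subrr normr0 mulr0.
Qed.
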